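(* Let $q$ be an odd prime power, let $A\in M_2(\mathbb{F}_{q^2})$, and assume that $F_A$ is nonsingular. Assume further that $A$ has at least one eigenvalue in $\mathbb{F}_{q^2}$ with a corresponding eigenvector $\mathbf u$ such that $\langle \mathbf u,\mathbf u\rangle\neq 0$. Let $z\in W(A)$, let $S_z=\{\mathbf v\in\mathbb{F}_{q^2}^2 : \langle A\mathbf v,\mathbf v\rangle=z,\ \langle\mathbf v,\mathbf v\rangle=1\}$, and let $\mathcal U=\{k+\beta\ell\in\mathbb{F}_{q^2}: k,\ell\in\mathbb{F}_q,\ k^2-\alpha\ell^2=1\}$. If $z\in\Gamma_{F_A}^\wedge$ then $|S_z/\mathcal U|=1$, and if $z\notin\Gamma_{F_A}^\wedge$ then $|S_z/\mathcal U|=2$. Equivalently, $|S_z|=q+1$ if $z\in\Gamma_{F_A}^\wedge$ and $|S_z|=2q+2$ if $z\notin\Gamma_{F_A}^\wedge$.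
   Context: Fix a nonsquare $\alpha\in\mathbb{F}_q$ and $\beta\in\mathbb{F}_{q^2}$ with $\beta^2=\alpha$, so every element of $\mathbb{F}_{q^2}$ is uniquely $x+\beta y$ with $x,y\in\mathbb{F}_q$. Write $\overline{x}:=x^q$. For a matrix $M$, $M^*$ is the transpose with $\overline{\cdot}$ applied entrywise. $\langle \mathbf u,\mathbf v\rangle:=\mathbf v^*\mathbf u$. The numerical range is $W(A)=\{\langle A\mathbf v,\mathbf v\rangle : \langle \mathbf v,\mathbf v\rangle=1\}$. Let $H_1=(A+A^* )/2$, $H_2=(A-A^* )/(2\beta)$, $F_A(x,y,t)=\det(xH_1+yH_2+tI_2)$; $F_A$ nonsingular means the projective curve $\Gamma_{F_A}:F_A=0$ has no singular points. $\Gamma_{F_A}^\wedge$ is the dual curve of $\Gamma_{F_A}$ (the points $(F_x(P):F_y(P):F_t(P))$ for nonsingular $P\in\Gamma_{F_A}$), whose points $(a:b:1)$, $a,b\in\mathbb{F}_q$, are identified with $a+\beta b\in\mathbb{F}_{q^2}$. $\mathcal U$ acts on $S_z$ by scalar multiplication and $S_z/\mathcal U$ is the set of orbits. *)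

(* Defs.v *)
From HB Require Import structures.
From mathcomp Require Import all_boot all_order all_algebra all_field.
From mathcomp Require Export mpoly.

Set Implicit Arguments.
Unset Strict Implicit.
Unset Printing Implicit Defensive.

Import GRing.Theory.
Local Open Scope ring_scope.

Section HermitianForm.
Variables (q : nat) (K : fieldType).

(* For #|K| = q ^ 2, x |-> x ^+ q is the conjugation of K over its subfield
   of order q. *)
Definition conj_trmx m n (M : 'M[K]_(m, n)) : 'M[K]_(n, m) :=
  map_mx (fun x => x ^+ q) M^T.

Definition hdot n (u v : 'cV[K]_n) : K := (conj_trmx v *m u) 0 0.

End HermitianForm.

Definition numrange (q : nat) (K : finFieldType) n (A : 'M[K]_n) : {set K} :=
  [set hdot q (A *m v) v | v : 'cV[K]_n & hdot q v v == 1].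

Section KippenhahnPolynomial.
Variables (q : nat) (K : fieldType) (beta : K) (n : nat) (A : 'M[K]_n).

Definition herm1 : 'M[K]_n := 2%:R^-1 *: (A + conj_trmx q A).

Definition herm2 : 'M[K]_n := (2%:R * beta)^-1 *: (A - conj_trmx q A).

(* The variables x, y, t are 'X_0, 'X_1, 'X_2. *)
Definition kippenhahn : {mpoly K[3]} :=
  \det ('X_(0 : 'I_3) *: map_mx (@mpolyC 3 K) herm1
        + 'X_(1 : 'I_3) *: map_mx (@mpolyC 3 K) herm2
        + 'X_(2%:R : 'I_3) *: 1%:M).

End KippenhahnPolynomial.

(* Points of the projective plane over L are represented by nonzero row
   vectors; L is meant to be algebraically closed and f homogeneous. *)
Section PlaneCurve.
Variables (L : fieldType) (f : {mpoly L[3]}).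
Implicit Types P Q : 'rV[L]_3.

Definition curve_point P : Prop := P != 0 /\ f.@[P 0] = 0.

Definition gradient P : 'rV[L]_3 := \row_i (f^`M(i)).@[P 0].

Definition nonsingular_curve : Prop :=
  forall P, curve_point P -> gradient P != 0.

(* The last clause is equality of projective points. *)
Definition dual_curve Q : Prop :=
  exists P, [/\ curve_point P, gradient P != 0
              & exists2 c : L, c != 0 & gradient P = c *: Q].

End PlaneCurve.

(* The point a + beta b of K, with a and b in F, is identified with the
   point (a : b : 1) of the projective plane over L. *)
Definition on_dual_curve (F K L : fieldType) (iota : {rmorphism F -> K})
    (j : {rmorphism K -> L}) (beta : K) (f : {mpoly L[3]}) (z : K) : Prop :=
  exists a b : F, z = iota a + beta * iota b /\
    dual_curve f (\row_(i < 3) [:: j (iota a); j (iota b); 1]`_i).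

Definition sphere_fiber (q : nat) (K : finFieldType) n (A : 'M[K]_n) (z : K) :
    {set 'cV[K]_n} :=
  [set v | (hdot q (A *m v) v == z) && (hdot q v v == 1)].

Definition unit_circle (F K : finFieldType) (iota : {rmorphism F -> K})
    (alpha : F) (beta : K) : {set K} :=
  [set iota k + beta * iota l | k in F, l in F & k ^+ 2 - alpha * l ^+ 2 == 1].

(* This is S / U when U is a group of scalars and S is stable under U. *)
Definition scalar_orbits (K : finFieldType) n (U : {set K})
    (S : {set 'cV[K]_n}) : {set {set 'cV[K]_n}} :=
  [set [set u *: v | u in U] | v in S].

(* Main.v *)
Require Import Defs.
From HB Require Import structures.
From mathcomp Require Import all_boot all_order all_algebra all_field ring zify.
Set Implicit Arguments.
Unset Strict Implicit.
Unset Printing Implicit Defensive.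
Import GRing.Theory.
Local Open Scope ring_scope.

(** A unitary change of basis starting with the given eigenvector makes A upper
    triangular, [[l, c], [0, m]], and preserves both F_A and the cardinality of
    S_z.  Put d = l - m, s = z - m and write |x|^2 = x^(q+1).  A unit vector v
    with N = |v_1|^2 lies over z iff s = d N + c v_2 v_1^q, so N is a root in
    F_q of
      (|d|^2 + |c|^2) N^2 - (Tr(s d^q) + |c|^2) N + |s|^2,
    and conversely each root in F_q comes from exactly q + 1 vectors, i.e. one
    U-orbit.  The conic F_A is nonsingular iff c and the leading coefficient
    |d|^2 + |c|^2 are nonzero, and z is on the dual conic iff the discriminant
    of this quadratic vanishes.  As z is in W(A), there is at least one root in
    F_q, hence there are one or two according to the discriminant. *)

(** * Norm and conjugation *)

Lemma card_roots_le (R : finIdomainType) (p : {poly R}) :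
  p != 0 -> (#|[set x | root p x]| <= (size p).-1)%N.
Proof.
move=> p0; have := @max_poly_roots R p (enum [set x | root p x]) p0.
rewrite -cardE enum_uniq => H.
have: (#|[set x | root p x]| < size p)%N.
  by apply: H => //; apply/allP => x; rewrite mem_enum inE.
by case: (size p).
Qed.

Section QuadraticExtension.
Variables (q : nat) (K : finFieldType).
Hypothesis cardK : #|K| = (q ^ 2)%N.

Lemma card_base_gt1 : (1 < q)%N.
Proof. by have := finNzRing_gt1 K; rewrite cardK; case: q => [|[]]. Qed.

(** As q divides q^2 = |K|, it is a power of the characteristic, so x |-> x^q is an iterate of
    Frobenius. Having it as a morphism [f] lets later proofs compute with conjugates by [ring] and
    [field]. *)
Lemma conj_rmorphism : exists f : {rmorphism K -> K}, forall x, f x = x ^+ q.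
Proof.
have [p p_pr pK] := finPcharP K.
have q_nat : [pchar K].-nat q.
  have := card_pprimeChar pK; rewrite cardK => cK.
  rewrite (eq_pnat _ (pcharf_eq pK)).
  apply: (@pnat_dvd _ (q ^ 2)%N); first by rewrite expnS dvdn_mulr.
  by rewrite cK pnatX pnat_id.
pose f (x : K) := x ^+ q.
have fB : zmod_morphism f 
  by move=> x y; rewrite /f exprDn_pchar // exprNn_pchar.
have fM : GRing.monoid_morphism f.
  by split; rewrite /f ?expr1n // => x y; rewrite exprMn.
pose F1 := GRing.isZmodMorphism.Build K K f fB.
pose F2 := GRing.isMonoidMorphism.Build K K f fM.
by exists (HB.pack_for {rmorphism K -> K} f F1 F2).
Qed.

Lemma conj_involutive (x : K) : (x ^+ q) ^+ q = x.
Proof. by rewrite -exprM mulnn -cardK expf_card. Qed.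

Lemma norm_conj (x : K) : (x ^+ q.+1) ^+ q = x ^+ q.+1.
Proof. by rewrite exprS exprMn conj_involutive mulrC. Qed.

Lemma card_conj_fixed : (#|[set x : K | x ^+ q == x]| <= q)%N.
Proof.
have q1 := card_base_gt1.
have sz : size ('X^q - 'X : {poly K}) = q.+1.
  by rewrite size_polyDl ?size_polyXn // size_polyN size_polyX ltnS.
have p0 : ('X^q - 'X : {poly K}) != 0 by rewrite -size_poly_eq0 sz.
have := card_roots_le p0; rewrite sz; apply: leq_trans; apply: subset_leq_card.
apply/subsetP => x; rewrite !inE => /eqP xq.
by rewrite rootE !hornerE ?hornerXn xq subrr.
Qed.

Lemma card_norm_fiber_le (N : K) : (#|[set x : K | x ^+ q.+1 == N]| <= q.+1)%N.
Proof.
have sz : size ('X^(q.+1) - N%:P : {poly K}) = q.+2.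
  by rewrite size_XnsubC.
have p0 : ('X^(q.+1) - N%:P : {poly K}) != 0 by rewrite -size_poly_eq0 sz.
have := card_roots_le p0; rewrite sz; apply: leq_trans; apply: subset_leq_card.
apply/subsetP => x; rewrite !inE => /eqP xq.
by rewrite rootE !hornerE ?hornerXn xq subrr.
Qed.

(* The q^2 - 1 nonzero elements fall into at most q - 1 norm fibers, each of
   cardinality at most q + 1, so both bounds are attained. *)
Lemma card_norm_fiber (N : K) :
  N ^+ q = N -> N != 0 -> #|[set x : K | x ^+ q.+1 == N]| = q.+1.
Proof.
move=> NF N0.
have q1 := card_base_gt1.
pose B := [set x : K | x ^+ q == x] :\ 0.
pose fib (M : K) := #|[set x : K | x ^+ q.+1 == M]|.
have cB : (#|B| <= q.-1)%N.
  have := card_conj_fixed; rewrite (cardsD1 0) -/B inE expr0n.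
  by case: (q) q1 => //= r _; rewrite eqxx.
have tot : (\sum_(M in B) fib M = #|K|.-1)%N.
  have -> : (#|K|.-1 = \sum_(x : K | x != 0%R) 1)%N.
    by rewrite sum1_card -(cardC1 (0 : K)); apply: eq_card => x; rewrite !inE.
  rewrite [RHS](partition_big (fun x : K => x ^+ q.+1) (mem B)) /=; last first.
    move=> x x0; rewrite in_setD1 inE norm_conj eqxx andbT.
    by rewrite expf_eq0 /= (negPf x0).
  apply: eq_bigr => M; rewrite !inE => /andP [M0 _].
  rewrite /fib sum1_card; apply: eq_card => x.
  rewrite inE unfold_in; case: eqVneq => [xM|]; last by rewrite andbF.
  by case: (eqVneq x 0) xM M0 => [->|//]; rewrite expr0n => <-; rewrite eqxx.
have NB : N \in B by rewrite !inE N0 NF eqxx.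
apply/eqP; rewrite eqn_leq card_norm_fiber_le /=.
have le : (\sum_(M in B | M != N) fib M <= \sum_(M in B | M != N) q.+1)%N.
  by apply: leq_sum => M _; apply: card_norm_fiber_le.
move: tot; rewrite (bigD1 N NB) /= cardK => tot.
move: le; rewrite sum_nat_const.
have -> : #|[pred M in B | M != N]| = #|B|.-1.
  rewrite (cardsD1 N B) NB add1n /=; apply: eq_card => x.
  by rewrite !inE andbC.
(* The other fibers hold at most (q - 2)(q + 1) = (q^2 - 1) - (q + 1) elements, which leaves at
   least q + 1 for [fib N]. *)
move=> le; have le' : (#|B|.-1 * q.+1 <= (q - 2) * q.+1)%N.
  by apply: leq_mul => //; lia.
have := leq_trans le le'; rewrite -/(fib N).
have {tot}: (fib N + \sum_(M in B | M != N) fib M)%N = (q ^ 2).-1 by [].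
move: (fib N) (\sum_(M in B | M != N) fib M)%N => a b.
case: (q) q1 => [|[|r]] // _; rewrite -mulnn !subSS subn0; nia.
Qed.

End QuadraticExtension.

(** * Orbits and unitary equivalence *)

Lemma sum_ord2 (V : nmodType) (F : 'I_2 -> V) : \sum_i F i = F 0 + F 1.
Proof.
rewrite !big_ord_recl big_ord0 addr0; congr (_ + F _); exact: val_inj.
Qed.

(** Since the identity is itself [P *m Q], the whole pencil is multiplied by P on the left and Q on
    the right, and det P det Q = 1. *)
Lemma det_pencil_conj (R : comPzRingType) n (P Q M N : 'M[R]_n) (a b c : R) :
    P *m Q = 1%:M ->
  \det (a *: (P *m M *m Q) + b *: (P *m N *m Q) + c *: 1%:M)
  = \det (a *: M + b *: N + c *: 1%:M).
Proof.
move=> PQ; have dPQ : \det P * \det Q = 1 by rewrite -det_mulmx PQ det1.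
rewrite -[RHS]mul1r -[X in _ = X * _]dPQ mulrAC -!det_mulmx; congr (\det _).
by rewrite !mulmxDr !mulmxDl -!scalemxAr -!scalemxAl mulmx1 PQ.
Qed.

Lemma mx2P (T : Type) (A B : 'M[T]_2) :
    A 0 0 = B 0 0 -> A 0 1 = B 0 1 -> A 1 0 = B 1 0 -> A 1 1 = B 1 1 -> A = B.
Proof.
move=> e00 e01 e10 e11; apply/matrixP => i k.
have ord2 (l : 'I_2) : l = 0 \/ l = 1.
  by case: l => -[|[|//]] lt; [left | right]; apply: val_inj.
by case: (ord2 i) => ->; case: (ord2 k) => ->.
Qed.

(** U is a group of scalars acting freely on nonzero vectors, so the orbits partition S into classes
    of size |U|. *)
Lemma card_scalar_orbits (K : finFieldType) n (U : {set K})
    (S : {set 'cV[K]_n}) :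
    1 \in U -> 0 \notin U -> {in U &, forall u w, u * w \in U} ->
    {in U, forall u, u^-1 \in U} ->
    0 \notin S -> {in U & S, forall u v, u *: v \in S} ->
  #|S| = (#|scalar_orbits U S| * #|U|)%N.
Proof.
move=> U1 U0 UM UV S0 US; apply: card_uniform_partition.
  move=> _ /imsetP [v vS ->]; rewrite card_in_imset // => u w uU wU /eqP.
  rewrite -subr_eq0 -scalerBl scaler_eq0 subr_eq0 => /orP [/eqP //|/eqP v0].
  by rewrite -v0 vS in S0.
apply/and3P; split.
- apply/eqP/setP => v; apply/bigcupP/idP => [[_ /imsetP [w wS ->]]|vS].
    by case/imsetP => u uU ->; apply: US.
  exists [set u *: v | u in U]; first exact: imset_f.
  by apply/imsetP; exists 1; rewrite ?scale1r.
- apply/trivIsetP => _ _ /imsetP [v vS ->] /imsetP [w wS ->].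
  apply: contraNT => /pred0Pn [_ /andP [/imsetP [a aU ->] /imsetP [b bU avbw]]].
  have neq0 u : u \in U -> u != 0 by apply: contraL => /eqP ->.
  have vE : v = (a^-1 * b) *: w.
    by rewrite -scalerA -avbw scalerA mulVf ?neq0 // scale1r.
  have wE : w = (b^-1 * a) *: v.
    by rewrite -scalerA avbw scalerA mulVf ?neq0 // scale1r.
  rewrite eqEsubset; apply/andP; split; apply/subsetP => _ /imsetP [u uU ->].
    by rewrite vE scalerA; apply: imset_f; rewrite !UM ?UV.
  by rewrite wE scalerA; apply: imset_f; rewrite !UM ?UV.
- apply/imsetP => -[v vS Uv].
  have: 1 *: v \in set0 by rewrite Uv; apply: imset_f.
  by rewrite inE.
Qed.

Section Hermitian.
Variables (q : nat) (K : finFieldType).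
Hypothesis cardK : #|K| = (q ^ 2)%N.

Lemma hdot2E (u v : 'cV[K]_2) :
  hdot q u v = v 0 0 ^+ q * u 0 0 + v 1 0 ^+ q * u 1 0.
Proof. by rewrite /hdot mxE sum_ord2 !mxE. Qed.

Lemma conj_trmxM m n p (M : 'M[K]_(m, n)) (N : 'M[K]_(n, p)) :
  conj_trmx q (M *m N) = conj_trmx q N *m conj_trmx q M.
Proof.
have [f fE] := conj_rmorphism cardK.
have cE m' n' (B : 'M[K]_(m', n')) : conj_trmx q B = map_mx f B^T.
  by apply/matrixP => i j; rewrite !mxE fE.
by rewrite !cE trmx_mul map_mxM.
Qed.

Lemma conj_trmxK m n (M : 'M[K]_(m, n)) : conj_trmx q (conj_trmx q M) = M.
Proof. by apply/matrixP => i j; rewrite !mxE conj_involutive. Qed.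

Section UnitaryInvariance.
Variables (n : nat) (V : 'M[K]_n).
Hypothesis VV : conj_trmx q V *m V = 1%:M.

Lemma hdot_unitary (u v : 'cV[K]_n) : hdot q (V *m u) (V *m v) = hdot q u v.
Proof. by rewrite /hdot conj_trmxM mulmxA -(mulmxA _ _ V) VV mulmx1. Qed.

Lemma card_sphere_fiber_unitary (A : 'M[K]_n) (z : K) :
  #|sphere_fiber q (conj_trmx q V *m A *m V) z| = #|sphere_fiber q A z|.
Proof.
have VV' := mulmx1C VV.
have VK (v : 'cV[K]_n) : conj_trmx q V *m (V *m v) = v.
  by rewrite mulmxA VV mul1mx.
rewrite -(card_imset _ (can_inj VK)); apply: eq_card => v.
have vE : v = V *m (conj_trmx q V *m v) by rewrite mulmxA VV' mul1mx.
have mem w : (V *m w \in sphere_fiber q A z)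
    = (w \in sphere_fiber q (conj_trmx q V *m A *m V) z).
  rewrite !inE hdot_unitary; congr (_ && _).
  by rewrite -[in RHS]hdot_unitary !mulmxA VV' mul1mx.
by rewrite vE (mem_imset _ _ (can_inj VK)) mem.
Qed.

(** Conjugation by a unitary matrix commutes with the adjoint, hence with forming both Hermitian
    parts, and so conjugates the pencil. *)
Lemma kippenhahn_unitary (beta : K) (A : 'M[K]_n) :
  kippenhahn q beta (conj_trmx q V *m A *m V) = kippenhahn q beta A.
Proof.
set V' := conj_trmx q V.
have h1 : herm1 q (V' *m A *m V) = V' *m herm1 q A *m V.
  rewrite /herm1 !conj_trmxM conj_trmxK -scalemxAr -scalemxAl.
  by rewrite mulmxDr mulmxDl !mulmxA.
have h2 : herm2 q beta (V' *m A *m V) = V' *m herm2 q beta A *m V.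
  rewrite /herm2 !conj_trmxM conj_trmxK -scalemxAr -scalemxAl.
  by rewrite mulmxBr mulmxBl !mulmxA.
rewrite /kippenhahn h1 h2 !map_mxM; apply: det_pencil_conj.
by rewrite -map_mxM VV map_mx1.
Qed.

End UnitaryInvariance.

(** The inverse of [hdot q u u] is fixed by conjugation, hence a norm, so u can be scaled to a unit
    vector v. Completing v to an orthonormal basis makes the lower left entry lambda times a product
    of orthogonal vectors. *)
Lemma unitary_triangularization (A : 'M[K]_2) (lambda : K) (u : 'cV[K]_2) :
    A *m u = lambda *: u -> hdot q u u != 0 ->
  exists2 V : 'M[K]_2, conj_trmx q V *m V = 1%:M
    & (conj_trmx q V *m A *m V) 1 0 = 0.
Proof.
have [f fE] := conj_rmorphism cardK.
have ffE x : f (f x) = x by rewrite !fE conj_involutive.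
move=> Au uu0.
have [x xN] : exists x : K, x ^+ q.+1 = (hdot q u u)^-1.
  have : (0 < #|[set x : K | x ^+ q.+1 == (hdot q u u)^-1%R]|)%N.
    rewrite card_norm_fiber ?invr_eq0 // -!fE fmorphV; congr _^-1.
    rewrite hdot2E -!fE rmorphD !rmorphM /= !ffE; ring.
  by case/card_gt0P => x; rewrite inE => /eqP; exists x.
have x0 : x != 0.
  by apply: contra_neq uu0 => x0; apply: invr_inj; rewrite -xN x0 expr0n invr0.
pose v := x *: u.
have Av : A *m v = lambda *: v by rewrite -scalemxAr Au scalerA mulrC -scalerA.
have vv : f (v 0 0) * v 0 0 + f (v 1 0) * v 1 0 = 1.
  have := mulVf uu0; rewrite -xN exprS hdot2E -!fE !mxE !rmorphM => <-; ring.
clearbody v.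
(* In dimension two this vector is orthogonal to v and has the same norm form value as v. *)
pose w : 'cV[K]_2 := \col_i [:: - f (v 1 0); f (v 0 0)]`_i.
pose V : 'M[K]_2 := \matrix_(i, k) if k == 0 then v i 0 else w i 0.
have VV : conj_trmx q V *m V = 1%:M.
  apply: mx2P; rewrite !mxE !sum_ord2 !mxE /= -!fE ?vv;
    rewrite ?rmorphN /= ?ffE ?addr0 //; try ring.
  by rewrite -vv; ring.
exists V => //.
(* Entries of column 0 involve only the first column of V, which is v. *)
have -> : (conj_trmx q V *m A *m V) 1 0 = (conj_trmx q V *m (A *m v)) 1 0.
  rewrite -mulmxA !mxE; apply: eq_bigr => i _; congr (_ * _).
  by rewrite !mxE; apply: eq_bigr => k _; rewrite !mxE.
rewrite Av -scalemxAr mxE.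
have -> : (conj_trmx q V *m v) 1 0 = (conj_trmx q V *m V) 1 0.
  by rewrite !mxE; apply: eq_bigr => k _; rewrite !mxE.
by rewrite VV mxE mulr0.
Qed.

End Hermitian.

(** * The fiber for a triangular matrix *)

Definition col2 (K : Type) (x y : K) : 'cV[K]_2 := \col_i if i == 0 then x else y.

Lemma col2E (K : Type) (v : 'cV[K]_2) : v = col2 (v 0 0) (v 1 0).
Proof.
apply/matrixP => i k; rewrite ord1 mxE.
by case: i => -[|[|//]] lt /=; congr (v _ _); apply: val_inj.
Qed.

Section TriangularFiber.
Variables (q : nat) (K : finFieldType).
Hypothesis cardK : #|K| = (q ^ 2)%N.
Variables (A : 'M[K]_2) (z : K).
Hypotheses (A10 : A 1 0 = 0) (A01 : A 0 1 != 0).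

(* Possible values of |v_1|^2 for v in the fiber over z; the first condition
   says that N lies in the subfield of order q. *)
Definition fiber_roots : {set K} :=
  let d := A 0 0 - A 1 1 in let c := A 0 1 in let s := z - A 1 1 in
  [set N | (N ^+ q == N)
         & (d ^+ q.+1 + c ^+ q.+1) * N ^+ 2
           - (s * d ^+ q + s ^+ q * d + c ^+ q.+1) * N + s ^+ q.+1 == 0].

(** Subtracting [A 1 1] times |v_1|^2 + |v_2|^2 = 1 from the condition over z eliminates |v_2|^2. *)
Lemma mem_sphere_triangular (v : 'cV[K]_2) :
  (v \in sphere_fiber q A z)
  = (v 0 0 ^+ q.+1 + v 1 0 ^+ q.+1 == 1)
    && (z - A 1 1 == (A 0 0 - A 1 1) * v 0 0 ^+ q.+1
        + A 0 1 * (v 1 0 * v 0 0 ^+ q)).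
Proof.
rewrite inE !hdot2E !mxE !sum_ord2 A10 mul0r add0r andbC !exprSr.
apply: andb_id2l => /eqP vv; rewrite -subr_eq0 -[RHS]subr_eq0 -oppr_eq0.
by congr (_ == 0); rewrite -[z - A 1 1]mulr1 -[in LHS](mulr1 z) -vv; ring.
Qed.

(** For N nonzero, v_1 is any of the q + 1 elements of norm N and determines v_2 because c is
    nonzero. For N = 0, v_1 vanishes and v_2 is any of the q + 1 elements of norm 1. *)
Lemma card_sphere_norm_slice (N : K) : N \in fiber_roots ->
  #|[set v in sphere_fiber q A z | v 0 0 ^+ q.+1 == N]| = q.+1.
Proof.
have [f fE] := conj_rmorphism cardK.
have ffE x : f (f x) = x by rewrite !fE conj_involutive.
have q0 : (0 < q)%N by rewrite ltnW ?(card_base_gt1 cardK).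
rewrite inE; set d := A 0 0 - A 1 1; set c := A 0 1; set s := z - A 1 1.
case/andP => /eqP Nq /eqP eqN.
have fN : f N = N by rewrite fE.
have [N0|N0] := eqVneq N 0.
  have s0 : s = 0.
    move/eqP: eqN; rewrite N0 expr0n /= !mulr0 subrr add0r expf_eq0 /=.
    by move/eqP.
  have inj : injective (col2 (0 : K)).
    by move=> x y /matrixP /(_ 1 0); rewrite !mxE.
  rewrite -[RHS](card_norm_fiber cardK (expr1n _ q) (oner_neq0 K)).
  rewrite -(card_imset _ inj).
  apply: eq_card => v; rewrite inE mem_sphere_triangular -/d -/c -/s s0 N0.
  apply/idP/imsetP => [/andP [/andP [v1 _] v0]|[x]].
    move: v0 v1; rewrite expf_eq0 /= => /eqP v0.
    rewrite v0 expr0n /= add0r => v1.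
    by exists (v 1 0); rewrite ?inE // {1}[v]col2E v0.
  rewrite inE => /eqP xN ->; rewrite !mxE /= xN !expr0n /= (gtn_eqF q0).
  by rewrite !mulr0 !add0r !eqxx.
(* The second coordinate is solved from s = d N + c v_2 v_1^q. *)
pose g x := col2 x ((s - d * N) / c / x ^+ q).
have inj : injective g.
  by move=> x y /matrixP /(_ 0 0); rewrite !mxE.
rewrite -[RHS](card_norm_fiber cardK Nq N0) -(card_imset _ inj).
apply: eq_card => v; rewrite inE mem_sphere_triangular -/d -/c -/s.
apply/idP/imsetP => [/andP [/andP [_ /eqP sE] /eqP vN]|[x]].
  have v0 : v 0 0 ^+ q != 0.
    by apply: contra_neq N0 => v0; rewrite -vN exprS v0 mulr0.
  exists (v 0 0); rewrite ?inE ?vN // [LHS]col2E /g; congr col2.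
  by rewrite sE vN; field; rewrite v0.
rewrite inE => /eqP xN ->; rewrite !mxE /= xN eqxx andbT.
have x0 : x != 0 by apply: contra_neq N0 => x0; rewrite -xN x0 expr0n.
have fx0 : f x != 0 by rewrite fmorph_eq0.
apply/andP; split; last by apply/eqP; rewrite -!fE; field; rewrite fx0.
move: eqN xN; rewrite !(exprS _ q) -!fE => eqN xN.
have fc0 : f c != 0 by rewrite fmorph_eq0.
rewrite !rmorphM !fmorphV /= rmorphB rmorphM /= ffE fN -subr_eq0; apply/eqP.
(* The defect |v_1|^2 + |v_2|^2 - 1 is the quadratic at N divided by |c|^2 N. *)
have -> : N + (s - d * N) / c / f x * ((f s - f d * N) / f c / x) - 1
   = ((d * f d + c * f c) * N ^+ 2 - (s * f d + f s * d + c * f c) * N + s * f s)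
     / (c * f c * N).
  by rewrite -xN; field; rewrite fx0 x0 A01 fc0.
by rewrite eqN mul0r.
Qed.

(** Taking norms in s - d N = c v_2 v_1^q, with N = |v_1|^2, gives |s - d N|^2 = |c|^2 N (1 - N),
    which is the quadratic equation. So the slices over its roots exhaust the fiber. *)
Lemma card_sphere_triangular :
  #|sphere_fiber q A z| = (#|fiber_roots| * q.+1)%N.
Proof.
have [f fE] := conj_rmorphism cardK.
have ffE x : f (f x) = x by rewrite !fE conj_involutive.
rewrite -sum1_card (partition_big (fun v : 'cV[K]_2 => v 0 0 ^+ q.+1)
  (mem fiber_roots)) /=.
  rewrite -sum_nat_const; apply: eq_bigr => N NR.
  rewrite -[RHS](card_sphere_norm_slice NR) -sum1_card.
  by apply: eq_bigl => v; rewrite [RHS]inE.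
move=> v; rewrite mem_sphere_triangular inE norm_conj // eqxx /=.
case/andP => /eqP vv /eqP ->; rewrite !exprS -!fE in vv *.
have vv' : v 1 0 * f (v 1 0) = 1 - v 0 0 * f (v 0 0) by rewrite -vv addrC addKr.
move: (A 0 0 - A 1 1) (A 0 1) (v 0 0) (v 1 0) vv' => d c a b vv'.
rewrite !(rmorphD, rmorphM) /= !ffE; apply/eqP.
transitivity (c * f c * (a * f a) * (b * f b - (1 - a * f a))); first by ring.
by rewrite vv' subrr mulr0.
Qed.

End TriangularFiber.

(** * The Kippenhahn conic and its dual *)

Section LinearForms.
Variable R : comNzRingType.

Definition linform (a b c : R) : {mpoly R[3]} :=
  a *: 'X_(0 : 'I_3) + b *: 'X_(1 : 'I_3) + c *: 'X_(2%:R : 'I_3).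

Lemma linform_eval a b c (v : 'I_3 -> R) :
  (linform a b c).@[v] = a * v 0 + b * v 1 + c * v 2%:R.
Proof. by rewrite /linform !mevalD !mevalZ !mevalXU. Qed.

Lemma mderivXU (n : nat) (i k : 'I_n) : ('X_k : {mpoly R[n]})^`M(i) = (k == i)%:R.
Proof.
rewrite mderivX mnm1E; case: eqP => [->|_]; last by rewrite scale0r.
have -> : (U_(i) - U_(i) = 0)%MM by apply/mnmP => l; rewrite !mnmE subnn.
by rewrite mpolyX0 scale1r.
Qed.

Lemma linform_deriv a b c i : (linform a b c)^`M(i) = ([:: a; b; c]`_i)%:MP.
Proof.
rewrite /linform !mderivD !mderivZ !mderivXU.
by case: i => -[|[|[|//]]] lt; rewrite /= ?scaler0 ?addr0 ?add0r alg_mpolyC.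
Qed.

End LinearForms.

Lemma map_linform (R S : comNzRingType) (f : {rmorphism R -> S}) a b c :
  map_mpoly f (linform a b c) = linform (f a) (f b) (f c).
Proof. by rewrite /linform !rmorphD /= !map_mpolyZ !map_mpolyX. Qed.

Section Conic.
Variables (L : fieldType) (l1 l2 m1 m2 C al : L).
Hypotheses (two_neq0 : 2%:R != 0 :> L) (al_neq0 : al != 0).

(* This is F_A for an upper triangular A with diagonal entries l1 + beta l2 and
   m1 + beta m2, where C is the norm of the upper right entry and
   al = beta ^+ 2. *)
Definition conic : {mpoly L[3]} :=
  linform l1 l2 1 * linform m1 m2 1
  - (C / 4%:R) *: (linform 1 0 0 * linform 1 0 0
                   - al^-1 *: (linform 0 1 0 * linform 0 1 0)).

Let four_neq0 : 4%:R != 0 :> L.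
Proof. by rewrite (natrM _ 2 2) mulf_neq0. Qed.

Let point (x y t : L) : 'rV[L]_3 := \row_(i < 3) [:: x; y; t]`_i.

Let pointE (Q : 'rV[L]_3) x y t :
  (Q == point x y t) = [&& Q 0 0 == x, Q 0 1 == y & Q 0 2%:R == t].
Proof.
apply/eqP/and3P => [->|[/eqP x0 /eqP y0 /eqP t0]]; first by rewrite !mxE.
apply/rowP => -[[|[|[|//]]] lt]; rewrite mxE /= -?x0 -?y0 -?t0;
  congr (Q _ _); exact: val_inj.
Qed.

Let point_neq0 x y t : point x y t = 0 -> [/\ x = 0, y = 0 & t = 0].
Proof.
move=> /rowP E; have := E 0; have := E 1; have := E 2%:R.
by rewrite !mxE /= => -> -> ->.
Qed.

(** [T1] and [T2] evaluate the linear forms of the two diagonal entries; they are the factors of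
    [conic] when C = 0. *)
Let T1 (P : 'rV[L]_3) := l1 * P 0 0 + l2 * P 0 1 + P 0 2%:R.
Let T2 (P : 'rV[L]_3) := m1 * P 0 0 + m2 * P 0 1 + P 0 2%:R.

Lemma conic_eval (P : 'rV[L]_3) :
  conic.@[P 0] = T1 P * T2 P - C / 4%:R * (P 0 0 ^+ 2 - P 0 1 ^+ 2 / al).
Proof.
rewrite /conic !(mevalB, mevalD, mevalZ, mevalM, linform_eval) /T1 /T2.
by field; rewrite al_neq0 four_neq0.
Qed.

Lemma conic_gradient (P : 'rV[L]_3) :
  gradient conic P = point (l1 * T2 P + m1 * T1 P - C / 2%:R * P 0 0)
    (l2 * T2 P + m2 * T1 P + C / (2%:R * al) * P 0 1) (T1 P + T2 P).
Proof.
apply/eqP; rewrite pointE !mxE /conic !(mderivB, mderivZ, mderivM, linform_deriv).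
rewrite !(mevalB, mevalD, mevalZ, mevalM, linform_eval, mevalC) /= /T1 /T2.
apply/and3P; split; apply/eqP; field; by rewrite ?al_neq0 ?four_neq0 ?two_neq0.
Qed.

(** The symmetric matrix of the conic has determinant - C E / (16 al), so neither C nor E may
    vanish; in each case a singular point is exhibited. *)
Lemma nonsingular_conic : nonsingular_curve conic ->
  C != 0 /\ (l1 - m1) ^+ 2 - al * (l2 - m2) ^+ 2 + C != 0.
Proof.
set d1 := l1 - m1; set d2 := l2 - m2; set E := _ + C => ns.
have C0 : C != 0.
  apply/eqP => C0.
  (* For C = 0 the curve is the pair of lines T1 = 0 and T2 = 0. They meet where d1 x + d2 y = T1 -
     T2 vanishes, once the third coordinate is chosen to make T2 zero. *)
  have [x [y [xy0 dxy]]] : exists x y, (x != 0) || (y != 0) /\ d1 * x + d2 * y = 0.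
    have [e2|] := eqVneq d2 0; have [e1|] := eqVneq d1 0.
    - by exists 1, 0; rewrite oner_neq0 e1 e2 !mul0r addr0.
    - by exists 0, 1; rewrite oner_neq0 orbT e2 mulr0 mul0r addr0.
    - by exists 1, 0; rewrite oner_neq0 e1 mulr0 mul0r addr0.
    by move=> d1n d2n; exists d2, (- d1); split; [rewrite d2n | ring].
  pose P := point x y (- (m1 * x + m2 * y)).
  have t2 : T2 P = 0 by rewrite /T2 !mxE /=; ring.
  have t1 : T1 P = 0 by rewrite /T1 !mxE /= -dxy /d1 /d2; ring.
  have := ns P; rewrite conic_gradient t1 t2 C0 !(mulr0, mul0r, addr0, subr0).
  case/(_ _)/eqP; last by apply/rowP => -[[|[|[|//]]] lt]; rewrite !mxE.
  split; last by rewrite conic_eval t1 C0 !mul0r subr0.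
  by apply: contraTneq xy0 => /point_neq0 [-> -> _]; rewrite eqxx.
split=> //; apply/eqP => E0.
(* The singular point with T1 P = -1 and T2 P = 1. *)
pose P := point (2%:R * d1 / C) (- 2%:R * al * d2 / C)
  (1 - m1 * (2%:R * d1 / C) - m2 * (- 2%:R * al * d2 / C)).
have t2 : T2 P = 1 by rewrite /T2 !mxE /=; ring.
have t1 : T1 P = - 1.
  have -> : T1 P = 2%:R * E / C - 1.
    by rewrite /T1 !mxE /= /E /d1 /d2; field.
  by rewrite E0 mulr0 mul0r sub0r.
have := ns P; rewrite conic_gradient t1 t2 !mxE /=.
case/(_ _)/eqP; last first.
  apply/eqP; rewrite eq_sym pointE !mxE /d1 /d2.
  by apply/and3P; split; apply/eqP; field; rewrite ?C0 ?al_neq0.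
split.
  by apply: contra_eq_neq t2 => ->; rewrite /T2 !mxE !mulr0 !addr0 eq_sym oner_neq0.
rewrite conic_eval t1 t2 !mxE /=.
transitivity (- E / C); last by rewrite E0 oppr0 mul0r.
by rewrite /E /d1 /d2; field; rewrite C0 al_neq0 four_neq0.
Qed.

(** The equation is the vanishing of the discriminant of the quadratic in N. If the gradient at P is
    k (a, b, 1), the double root is T2 P / k; conversely, a double root determines such a P. *)
Lemma dual_conic a b :
    C != 0 -> (l1 - m1) ^+ 2 - al * (l2 - m2) ^+ 2 + C != 0 ->
  dual_curve conic (\row_(i < 3) [:: a; b; 1]`_i) <->
  (2%:R * ((a - m1) * (l1 - m1) - al * ((b - m2) * (l2 - m2))) + C) ^+ 2
  = 4%:R * ((l1 - m1) ^+ 2 - al * (l2 - m2) ^+ 2 + C)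
    * ((a - m1) ^+ 2 - al * (b - m2) ^+ 2).
Proof.
rewrite -/(point a b 1).
set d1 := l1 - m1; set d2 := l2 - m2; set E := _ + C.
move=> C0 E0; split=> [[P [[P0 GP] _ [k k0]]]|D0].
  have -> : k *: point a b 1 = point (k * a) (k * b) k.
    by apply/eqP; rewrite pointE !mxE /= mulr1 !eqxx.
  move/eqP; rewrite conic_gradient eq_sym pointE !mxE /=.
  move: GP; rewrite conic_eval.
  have TE : T1 P = T2 P + d1 * P 0 0 + d2 * P 0 1.
    by rewrite /T1 /T2 /d1 /d2; ring.
  move: (P 0 0) (P 0 1) TE => x y TE GP /and3P [/eqP ka /eqP kb /eqP kE].
  have k1 : k * (a - m1) = d1 * T2 P - C / 2%:R * x.
    by rewrite mulrBr ka kE /d1; ring.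
  have k2 : k * (b - m2) = d2 * T2 P + C / (2%:R * al) * y.
    by rewrite mulrBr kb kE /d2; ring.
  (* With N = T2 P / k and t the left-hand quantity before squaring, [Z1] and [Z2] read t = 2 E N
     and s1^2 - al s2^2 = E N^2, where s1 = a - m1 and s2 = b - m2. Eliminating N gives the
     claim. *)
  have Z1 : k * (2%:R * ((a - m1) * d1 - al * ((b - m2) * d2)) + C) = 2%:R * T2 P * E.
    transitivity (2%:R * (k * (a - m1) * d1 - al * (k * (b - m2) * d2)) + k * C).
      by ring.
    by rewrite k1 k2 kE TE /E; field; rewrite al_neq0.
  have Z2 : k ^+ 2 * ((a - m1) ^+ 2 - al * (b - m2) ^+ 2) = T2 P ^+ 2 * E.
    transitivity ((k * (a - m1)) ^+ 2 - al * (k * (b - m2)) ^+ 2); first by ring.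
    rewrite k1 k2; move/eqP: GP; rewrite subr_eq0 => /eqP GP.
    transitivity ((d1 ^+ 2 - al * d2 ^+ 2) * T2 P ^+ 2
       - C * T2 P * (d1 * x + d2 * y) + C * (C / 4%:R * (x ^+ 2 - y ^+ 2 / al))).
      by field; rewrite al_neq0 four_neq0.
    by rewrite -GP TE /E; ring.
  apply: (mulfI (expf_neq0 2 k0)); rewrite -exprMn Z1.
  transitivity (4%:R * E * (T2 P ^+ 2 * E)); first by ring.
  by rewrite -Z2; ring.
(* N is the double root of the quadratic; P solves T1 P = 1 - N, T2 P = N and
   gradient conic P = (a, b, 1). *)
pose s1 := a - m1; pose s2 := b - m2.
pose N := (2%:R * (s1 * d1 - al * (s2 * d2)) + C) / (2%:R * E).
have NE : 2%:R * (s1 * d1 - al * (s2 * d2)) = 2%:R * E * N - C.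
  by rewrite /N; field; rewrite E0.
have NN : s1 ^+ 2 - al * s2 ^+ 2 = E * N ^+ 2.
  apply: (mulfI (mulf_neq0 four_neq0 E0)); rewrite -D0 -/s1 -/s2 NE; ring.
pose x := 2%:R * (d1 * N - s1) / C.
pose y := 2%:R * al * (s2 - d2 * N) / C.
pose P := point x y (N - m1 * x - m2 * y).
have t2 : T2 P = N by rewrite /T2 !mxE /=; ring.
have t1 : T1 P = 1 - N.
  have -> : T1 P = (2%:R * (d1 ^+ 2 - al * d2 ^+ 2) * N
     - 2%:R * (s1 * d1 - al * (s2 * d2))) / C + N.
    by rewrite /T1 !mxE /= /x /y /d1 /d2; field.
  by rewrite NE /E; field.
have gP : gradient conic P = 1 *: point a b 1.
  rewrite conic_gradient t1 t2 scale1r !mxE /=; apply/eqP; rewrite eq_sym pointE.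
  rewrite !mxE /= /x /y /s1 /s2 /d1 /d2.
  by apply/and3P; split; apply/eqP; field; rewrite ?C0 ?al_neq0.
exists P; split.
- split.
    have : T1 P + T2 P != 0 by rewrite t1 t2 subrK oner_neq0.
    by apply: contra_neq => ->; rewrite /T1 /T2 !mxE !mulr0 !addr0.
  rewrite conic_eval t1 t2 !mxE /=.
  transitivity ((C * N - (d1 ^+ 2 - al * d2 ^+ 2) * N ^+ 2
    + 2%:R * N * (s1 * d1 - al * (s2 * d2)) - (s1 ^+ 2 - al * s2 ^+ 2)
    - C * N ^+ 2) / C).
    by rewrite /x /y; field; rewrite C0 al_neq0 four_neq0.
  by rewrite NN [2%:R * N]mulrC -mulrA NE /E; field.
- rewrite gP scale1r; apply/eqP => /point_neq0 [_ _ /eqP].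
  by rewrite oner_eq0.
by exists 1; rewrite ?oner_neq0.
Qed.

End Conic.

Lemma map_conic (K L : fieldType) (j : {rmorphism K -> L}) (l1 l2 m1 m2 C al : K) :
  map_mpoly j (conic l1 l2 m1 m2 C al)
  = conic (j l1) (j l2) (j m1) (j m2) (j C) (j al).
Proof.
rewrite /conic !(rmorphB, rmorphM) /= !map_mpolyZ !(rmorphB, rmorphM) /=.
rewrite !map_mpolyZ !rmorphM /= !map_linform rmorph1 rmorph0.
by rewrite !fmorphV rmorph_nat.
Qed.

(** * The polynomial F_A of a triangular matrix, and the number of roots *)

Lemma det_mx2 (R : comNzRingType) (M : 'M[R]_2) :
  \det M = M 0 0 * M 1 1 - M 0 1 * M 1 0.
Proof.
have lift01 : lift ord0 ord0 = 1 :> 'I_2 by apply: val_inj.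
have lift10 : lift (1 : 'I_2) ord0 = 0 :> 'I_2 by apply: val_inj.
rewrite (expand_det_row _ 0) sum_ord2 /cofactor !det_mx11 !mxE lift01 lift10 /=.
by rewrite expr0 mul1r expr1 mulN1r mulrN.
Qed.

(** This evaluates the product of the off-diagonal entries of the pencil, with a = c, b = c^q, h =
    1/2 and k = 1/beta. *)
Lemma linform_mul_conj (R : comNzRingType) (a b h k : R) :
  linform (h * a) (h * k * a) 0 * linform (h * b) (- (h * k * b)) 0
  = (a * b * h ^+ 2) *: (linform 1 0 0 * linform 1 0 0
                    - k ^+ 2 *: (linform 0 1 0 * linform 0 1 0)).
Proof.
rewrite /linform !scale0r !addr0 !add0r !scale1r -!mul_mpolyC !mpolyCN !mpolyCM.
ring.
Qed.

Section Triangular.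
Variables (q : nat) (K : finFieldType).
Hypotheses (cardK : #|K| = (q ^ 2)%N) (odd_q : odd q).

Lemma two_neq0 : 2%:R != 0 :> K.
Proof.
apply/eqP => two0; have [p p_pr pK] := finPcharP K.
have p2 : p = 2%N by apply/eqP; rewrite -dvdn_prime2 // (dvdn_pcharf pK) two0.
have := card_pprimeChar pK; have := finNzRing_gt1 K; rewrite cardK p2.
by case: (logn _ _) => [gt1 e|l _ /(congr1 odd)];
  [rewrite e in gt1 | rewrite !oddX odd_q].
Qed.

Lemma kippenhahn_triangular (A : 'M[K]_2) (beta : K) :
    A 1 0 = 0 -> beta != 0 -> beta ^+ q = - beta ->
  kippenhahn q beta A
  = conic ((A 0 0 + A 0 0 ^+ q) / 2%:R) ((A 0 0 - A 0 0 ^+ q) / (2%:R * beta))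
      ((A 1 1 + A 1 1 ^+ q) / 2%:R) ((A 1 1 - A 1 1 ^+ q) / (2%:R * beta))
      (A 0 1 ^+ q.+1) (beta ^+ 2).
Proof.
move=> A10 b0 bq; have t0 := two_neq0.
have q0 : (0 < q)%N by rewrite ltnW ?(card_base_gt1 cardK).
have lfE i k : ('X_(0 : 'I_3) *: map_mx (@mpolyC 3 K) (herm1 q A)
        + 'X_(1 : 'I_3) *: map_mx (@mpolyC 3 K) (herm2 q beta A)
        + 'X_(2%:R : 'I_3) *: 1%:M : 'M_2) i k
   = linform (herm1 q A i k) (herm2 q beta A i k) (i == k)%:R.
  rewrite /linform !mxE ![in LHS](mulrC _ (_%:MP)) !mul_mpolyC.
  by congr (_ + _); rewrite mulr_natr scaler_nat.
rewrite /kippenhahn det_mx2 !lfE /conic /= !mxE A10 expr0n (gtn_eqF q0) /=.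
rewrite ?addr0 ?add0r ?subr0 ?sub0r.
rewrite ![2%:R^-1 * _]mulrC ![(2%:R * beta)^-1 * _]mulrC.
congr (_ - _).
have -> : 4%:R^-1 = 2%:R^-1 ^+ 2 :> K by rewrite exprVn -natrX.
rewrite [A 0 1 ^+ q.+1]exprS -[beta ^- 2]exprVn -linform_mul_conj invfM.
by congr (linform _ _ _ * linform _ _ _); ring.
Qed.

(* Once one root lies in the subfield of order q, so does the other, their sum
   being in it; hence the count depends only on the discriminant. *)
Lemma card_fiber_roots (A : 'M[K]_2) (z N0 : K) :
  let d := A 0 0 - A 1 1 in let c := A 0 1 in let s := z - A 1 1 in
  let e := d ^+ q.+1 + c ^+ q.+1 in
  let t := s * d ^+ q + s ^+ q * d + c ^+ q.+1 in
  e != 0 -> N0 \in fiber_roots q A z ->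
  #|fiber_roots q A z| = (t ^+ 2 != 4%:R * e * s ^+ q.+1).+1.
Proof.
have [f fE] := conj_rmorphism cardK.
have ffE x : f (f x) = x by rewrite !fE conj_involutive.
move=> d c s e t e0 N0R; have t0 := two_neq0.
have nE x : f (x ^+ q.+1) = x ^+ q.+1 by rewrite fE norm_conj.
have fe : f e = e by rewrite /e rmorphD /= !nE.
have ft : f t = t by rewrite /t -!fE 2!rmorphD 2!rmorphM /= nE !ffE; ring.
pose N1 := t / e - N0.
have [fN0 qN0] : f N0 = N0 /\ e * N0 ^+ 2 - t * N0 + s ^+ q.+1 = 0.
  by move: N0R; rewrite inE fE => /andP [/eqP -> /eqP].
have RE : fiber_roots q A z = [set N0; N1].
  apply/setP => N; rewrite !inE -/d -/c -/s -/e -/t -[N ^+ q]fE.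
  have -> : e * N ^+ 2 - t * N + s ^+ q.+1 = e * (N - N0) * (N - N1).
    rewrite -[LHS]subr0 -{1}qN0 /N1; field; exact: e0.
  rewrite !mulf_eq0 (negPf e0) /= !subr_eq0 andb_idl //.
  case/orP => /eqP ->; first by rewrite fN0.
  by rewrite /N1 rmorphB fmorph_div /= ft fe fN0.
rewrite RE cards2; congr (nat_of_bool (~~ _)).+1.
(* The square of e (N0 - N1) is the discriminant. *)
have -> : (N0 == N1) = (e * (N0 - N1) == 0).
  by rewrite mulf_eq0 (negPf e0) subr_eq0.
rewrite -[RHS]subr_eq0 -[LHS](expf_eq0 _ 2); congr (_ == 0).
have -> : s ^+ q.+1 = t * N0 - e * N0 ^+ 2 by rewrite -[RHS]addr0 -qN0; ring.
by rewrite /N1; field.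
Qed.

End Triangular.

(** * The unit circle and the count *)

Section BaseField.
Variables (q : nat) (F K : finFieldType) (iota : {rmorphism F -> K}).
Hypotheses (cardF : #|F| = q) (cardK : #|K| = (q ^ 2)%N).

Lemma conj_iota a : iota a ^+ q = iota a.
Proof. by rewrite -rmorphXn -cardF expf_card. Qed.

(** The image of F consists of q fixed points, and there are at most q of them. *)
Lemma conj_fixed_iota (x : K) : x ^+ q = x -> exists a, x = iota a.
Proof.
have sub : [set iota a | a in F] \subset [set x : K | x ^+ q == x].
  by apply/subsetP => _ /imsetP [a _ ->]; rewrite inE conj_iota.
have eq : [set iota a | a in F] = [set x : K | x ^+ q == x].
  apply/eqP; rewrite eqEcard sub card_imset ?cardF ?card_conj_fixed //.
  exact: fmorph_inj.
move=> /eqP xq; have : x \in [set iota a | a in F] by rewrite eq inE.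
by case/imsetP => a _ ->; exists a.
Qed.

Variables (alpha : F) (beta : K).
Hypotheses (nonsquare : ~ exists x : F, x ^+ 2 = alpha)
  (betaE : beta ^+ 2 = iota alpha).

Lemma beta_neq0 : beta != 0.
Proof.
apply/eqP => b0; apply: nonsquare; exists 0; apply: (fmorph_inj iota).
by rewrite rmorphXn rmorph0 /= -betaE b0.
Qed.

(** Both sides have square alpha up to [iota], so the only alternative is that beta is fixed; it
    would then come from F and alpha would be a square. *)
Lemma conj_beta : beta ^+ q = - beta.
Proof.
have : (beta ^+ q) ^+ 2 == beta ^+ 2 by rewrite exprAC betaE conj_iota.
rewrite eqf_sqr => /orP [/eqP bq|/eqP //].
have [b bE] := conj_fixed_iota bq; case: nonsquare; exists b.
by apply: (fmorph_inj iota); rewrite rmorphXn /= -bE.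
Qed.

(** Both quotients are fixed by conjugation, the second because numerator and denominator change
    sign together. *)
Lemma iota_conj_coordinates (odd_q : odd q) (z : K) : exists a b : F,
  [/\ z = iota a + beta * iota b, iota a = (z + z ^+ q) / 2%:R
    & iota b = (z - z ^+ q) / (2%:R * beta)].
Proof.
have [f fE] := conj_rmorphism cardK; have t0 := two_neq0 cardK odd_q.
have fzz : f (f z) = z by rewrite !fE conj_involutive.
have b0 := beta_neq0; have fb : f beta = - beta by rewrite fE conj_beta.
have [|a aE] := @conj_fixed_iota ((z + z ^+ q) / 2%:R).
  by rewrite -!fE fmorph_div rmorphD /= fzz rmorph_nat addrC.
have [|b bE] := @conj_fixed_iota ((z - z ^+ q) / (2%:R * beta)).
  rewrite -!fE fmorph_div rmorphB rmorphM /= fzz rmorph_nat fb.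
  by field; rewrite oppr_eq0 b0 t0.
by exists a, b; rewrite -aE -bE; split=> //; field; rewrite b0 t0.
Qed.

Lemma conj_coordinates a b : (iota a + beta * iota b) ^+ q = iota a - beta * iota b.
Proof.
have [f fE] := conj_rmorphism cardK.
by rewrite -fE rmorphD rmorphM /= !fE !conj_iota conj_beta mulNr.
Qed.

(** k^2 - alpha l^2 is the norm of k + beta l. *)
Lemma unit_circleE (odd_q : odd q) :
  unit_circle iota alpha beta = [set x : K | x ^+ q.+1 == 1].
Proof.
have nE a b : (iota a + beta * iota b) ^+ q.+1 = iota (a ^+ 2 - alpha * b ^+ 2).
  transitivity (iota a ^+ 2 - iota alpha * iota b ^+ 2); last by ring.
  by rewrite exprS conj_coordinates -betaE; ring.
apply/setP => x; rewrite inE; apply/imset2P/eqP => [[k l _]|x1].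
  by rewrite inE => /andP [_ /eqP kl] ->; rewrite nE kl rmorph1.
have [a [b [xE _ _]]] := iota_conj_coordinates odd_q x.
exists a b; rewrite ?inE //=; apply/eqP/(fmorph_inj iota).
by rewrite rmorph1 -nE -xE.
Qed.

Lemma card_unit_circle (odd_q : odd q) : #|unit_circle iota alpha beta| = q.+1.
Proof. by rewrite unit_circleE // card_norm_fiber ?expr1n ?oner_neq0. Qed.

(** Scaling v by u multiplies both defining forms by u^(q+1) = 1, so U acts on the fiber, freely
    since 0 is not in it. *)
Lemma card_sphere_orbits (odd_q : odd q) n (A : 'M[K]_n) (z : K) :
  let S := sphere_fiber q A z in
  #|S| = (#|scalar_orbits (unit_circle iota alpha beta) S| * q.+1)%N.
Proof.
move=> S; rewrite -(card_unit_circle odd_q); apply: card_scalar_orbits.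
- by rewrite unit_circleE // inE expr1n.
- by rewrite unit_circleE // inE expr0n eq_sym oner_eq0.
- move=> u w; rewrite unit_circleE // !inE exprMn => /eqP -> /eqP ->.
  by rewrite mulr1.
- by move=> u; rewrite unit_circleE // !inE exprVn => /eqP ->; rewrite invr1.
- rewrite inE; have -> : hdot q (0 : 'cV[K]_n) 0 = 0 by rewrite /hdot mulmx0 mxE.
  by rewrite [0 == 1]eq_sym oner_eq0 andbF.
move=> u v; rewrite unit_circleE // !inE exprSr => /eqP u1 vS.
have hZ w : hdot q (u *: w) (u *: v) = hdot q w v.
  rewrite /hdot; have -> : conj_trmx q (u *: v) = u ^+ q *: conj_trmx q v.
    by apply/matrixP => i k; rewrite !mxE exprMn.
  by rewrite -scalemxAl -scalemxAr scalerA u1 scale1r.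
by rewrite -scalemxAr !hZ.
Qed.

End BaseField.

Theorem theorem1p5 (q : nat) (F K : finFieldType) (iota : {rmorphism F -> K})
    (L : closedFieldType) (j : {rmorphism K -> L})
    (alpha : F) (beta : K) (A : 'M[K]_2) (z : K) :
  odd q ->
  #|F| = q ->
  #|K| = (q ^ 2)%N ->
  integralRange j ->
  (~ exists x : F, x ^+ 2 = alpha) ->
  beta ^+ 2 = iota alpha ->
  nonsingular_curve (map_mpoly j (kippenhahn q beta A)) ->
  (exists (lambda : K) (u : 'cV[K]_2),
     [/\ u != 0, A *m u = lambda *: u & hdot q u u != 0]) ->
  z \in numrange q A ->
  let S := sphere_fiber q A z in
  let U := unit_circle iota alpha beta in
  let G := map_mpoly j (kippenhahn q beta A) in
  [/\ on_dual_curve iota j beta G z -> #|scalar_orbits U S| = 1%N,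
      ~ on_dual_curve iota j beta G z -> #|scalar_orbits U S| = 2%N,
      on_dual_curve iota j beta G z -> #|S| = (q + 1)%N
    & ~ on_dual_curve iota j beta G z -> #|S| = (2 * q + 2)%N].
Proof.
move=> odd_q cardF cardK _ nonsq bE ns [lambda [u [_ Au uu0]]] zA S U G.
have [f fE] := conj_rmorphism cardK; have t0 := two_neq0 cardK odd_q.
have b0 := beta_neq0 nonsq bE; have bq := conj_beta cardF cardK nonsq bE.
have [V VV] := unitary_triangularization cardK Au uu0.
have := card_sphere_fiber_unitary cardK VV A z.
have := kippenhahn_unitary cardK VV beta A; rewrite -/S.
(* The triangular matrix B replaces A: it has the same polynomial and a fiber of the same size. *)
move: (conj_trmx q V *m A *m V) => B kB SB B10.
have GE : G = map_mpoly j (kippenhahn q beta B) by rewrite kB.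
have GE' := GE.
rewrite (kippenhahn_triangular cardK odd_q B10 b0 bq) map_conic in GE'.
rewrite -/G GE' in ns.
(* Coordinates along 1 and beta, taken inside K, turn norms and traces into polynomial
   expressions. *)
have coord x : exists x1 x2, [/\ (x + x ^+ q) / 2%:R = x1,
    (x - x ^+ q) / (2%:R * beta) = x2, x = x1 + beta * x2 & x ^+ q = x1 - beta * x2].
  by do 2![eexists]; split; [by [] | by [] | |]; field; rewrite b0 t0.
have jt0 : 2%:R != 0 :> L by rewrite -(rmorph_nat j) fmorph_eq0.
have jb0 : j (beta ^+ 2) != 0 by rewrite fmorph_eq0 expf_neq0.
have [l1 [l2 [l1E l2E lE lqE]]] := coord (B 0 0).
have [m1 [m2 [m1E m2E mE mqE]]] := coord (B 1 1).
rewrite l1E l2E m1E m2E in GE' ns.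
have [] := nonsingular_conic jt0 jb0 ns; rewrite fmorph_eq0 => C0.
set d := B 0 0 - B 1 1; set c := B 0 1; set s := z - B 1 1.
have c0 : c != 0 by apply: contra_neq C0 => c0; rewrite -/c c0 expr0n.
have dE : d = l1 - m1 + beta * (l2 - m2) by rewrite /d lE mE; ring.
have dqE : d ^+ q = l1 - m1 - beta * (l2 - m2).
  by rewrite -fE rmorphB /= !fE lqE mqE; ring.
have eE : (l1 - m1) ^+ 2 - beta ^+ 2 * (l2 - m2) ^+ 2 + c ^+ q.+1
    = d ^+ q.+1 + c ^+ q.+1 by rewrite [d ^+ _]exprS dqE dE; ring.
have jE : (j l1 - j m1) ^+ 2 - j (beta ^+ 2) * (j l2 - j m2) ^+ 2 + j (c ^+ q.+1)
    = j (d ^+ q.+1 + c ^+ q.+1) by rewrite -eE; ring.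
rewrite jE fmorph_eq0 => e0.
have dualE : on_dual_curve iota j beta G z <->
    (s * d ^+ q + s ^+ q * d + c ^+ q.+1) ^+ 2
    = 4%:R * (d ^+ q.+1 + c ^+ q.+1) * s ^+ q.+1.
  have crit a b : z = iota a + beta * iota b ->
      dual_curve G (\row_(i < 3) [:: j (iota a); j (iota b); 1]`_i) <->
      (s * d ^+ q + s ^+ q * d + c ^+ q.+1) ^+ 2
      = 4%:R * (d ^+ q.+1 + c ^+ q.+1) * s ^+ q.+1.
    move=> zE; rewrite GE'; have [||D1 D2] := @dual_conic _ (j l1) (j l2) (j m1)
      (j m2) (j (c ^+ q.+1)) (j (beta ^+ 2)) jt0 jb0 (j (iota a)) (j (iota b)).
    - by rewrite fmorph_eq0.
    - by rewrite jE fmorph_eq0.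
    have sE : s = iota a - m1 + beta * (iota b - m2) by rewrite /s zE mE; ring.
    have sqE : s ^+ q = iota a - m1 - beta * (iota b - m2).
      rewrite -fE rmorphB /= !fE mqE zE.
      by rewrite (conj_coordinates cardF cardK nonsq bE); ring.
    (* 2 (s1 d1 - beta^2 s2 d2) is the trace s d^q + s^q d. *)
    have tE : 2%:R * ((j (iota a) - j m1) * (j l1 - j m1)
        - j (beta ^+ 2) * ((j (iota b) - j m2) * (j l2 - j m2))) + j (c ^+ q.+1)
        = j (s * d ^+ q + s ^+ q * d + c ^+ q.+1).
      by rewrite sqE sE dqE dE; ring.
    have nE : (j (iota a) - j m1) ^+ 2 - j (beta ^+ 2) * (j (iota b) - j m2) ^+ 2
        = j (s ^+ q.+1).
      by rewrite [s ^+ _]exprS sqE sE; ring.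
    rewrite tE nE jE in D1 D2.
    have jX x y w : j (4%:R * x * y) = 4%:R * j x * j y /\ j (w ^+ 2) = j w ^+ 2.
      by split; ring.
    have [rE lE'] := jX (d ^+ q.+1 + c ^+ q.+1) (s ^+ q.+1)
      (s * d ^+ q + s ^+ q * d + c ^+ q.+1).
    split=> [/D1 D|D]; first by apply: (fmorph_inj j); rewrite rE lE'.
    by apply: D2; rewrite -rE -lE' D.
  split=> [[a [b [zE]]]|D]; first by case: (crit a b zE).
  have [a [b [zE _ _]]] := iota_conj_coordinates cardF cardK nonsq bE odd_q z.
  by exists a, b; split; [exact: zE | exact: (crit a b zE).2].
have [v vS] : exists v, v \in S.
  by case/imsetP: zA => v; rewrite inE => vv zv; exists v; rewrite inE -zv eqxx.
(* Membership of z in W(A) makes the fiber nonempty, which excludes a quadratic without roots in the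
   subfield. *)
have [N NR] : exists N, N \in fiber_roots q B z.
  apply/card_gt0P; rewrite lt0n; apply: contraTneq vS => R0.
  have := card_sphere_triangular cardK z B10 c0; rewrite R0 mul0n SB => /eqP.
  by rewrite cards_eq0 => /eqP ->; rewrite inE.
have cardS : #|S| = (#|scalar_orbits U S| * q.+1)%N by apply: card_sphere_orbits.
have [cardR1 cardR2] : (on_dual_curve iota j beta G z -> #|fiber_roots q B z| = 1%N)
    /\ (~ on_dual_curve iota j beta G z -> #|fiber_roots q B z| = 2%N).
  rewrite (card_fiber_roots cardK odd_q e0 NR); split=> D.
    by rewrite (dualE.1 D) eqxx.
  by case: eqP => [disc0|_]; [case: (D (dualE.2 disc0)) | ].
(* Both counts of |S| carry the factor q + 1, so orbits and roots are equally many. *)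
have cardO : #|scalar_orbits U S| = #|fiber_roots q B z|.
  apply/eqP; rewrite -(eqn_pmul2r (ltn0Sn q)) -cardS -SB.
  by rewrite (card_sphere_triangular cardK z B10 c0).
split=> D; rewrite ?cardS cardO.
- exact: cardR1 D.
- exact: cardR2 D.
- by rewrite (cardR1 D) mul1n addn1.
by rewrite (cardR2 D) mulnS addnC.
Qed.
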